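(* There is a constant $C>0$ such that for every integer $n\ge 1$ there exists a quantum circuit acting on an $n$-qubit register and $\log_2^* n$ clean ancilla qubits, consisting of Toffoli gates and Clifford gates, that implements the $n$-bit incrementer $$|x\rangle\mapsto |(x+1) \bmod 2^n\rangle,\qquad x\in\{0,1,\dots,2^n-1\},$$ (extended linearly), uses at most $3n$ Toffoli gates, and has depth at most $Cn$.
   Context: The $n$-qubit register stores the integer $x$ in binary. $\log_2^* n$ is the iterated logarithm: the number of times $\log_2$ must be applied, starting from $n$, until the result is at most $1$. A Toffoli gate with controls $x,y$ and target $z$ (three distinct qubits) maps $|x,y,z\rangle\mapsto|x,y,z\oplus (x\wedge y)\rangle$. A clean ancilla qubit is a qubit that is guaranteed to be in state $|0\rangle$ at the start of the circuit and must be returned to $|0\rangle$ at the end, for every input on the other qubits. The depth of a circuit is the minimum number of layers into which its gates can be arranged so that gates in the same layer act on disjoint sets of qubits and the order of gates sharing a qubit is respected. *)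

(* Defs.v *)
From mathcomp Require Import all_boot all_order all_algebra.
From mathcomp Require Import reals exp.
From mathcomp.real_closed Require Export complex.

Set Implicit Arguments.
Unset Strict Implicit.
Unset Printing Implicit Defensive.

Import Order.TTheory GRing.Theory Num.Theory.
Local Open Scope ring_scope.

Section IteratedLogarithm.
Variable R : realType.

Definition log2 (x : R) : R := ln x / ln 2.

Lemma ex_log_star (n : nat) : exists k, iter k log2 n%:R <= 1.
Proof.
have ln2_gt0 : 0 < ln 2 :> R by rewrite ln_gt0 // ltr1n.
suff H m (x : R) : x <= m.+1%:R -> exists k, iter k log2 x <= 1.
  by apply: (H n); rewrite ler_nat.
elim: m x => [|m IHm] x lex; first by exists 0.
have [x_le1|x_gt1] := leP x 1; first by exists 0.
have x_gt0 : 0 < x by apply: lt_trans x_gt1.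
have [|k Hk] := IHm (log2 x); last by exists k.+1; rewrite iterSr.
rewrite /log2 ler_pdivrMr // mulr_natl -lnXn // ler_ln ?posrE ?exprn_gt0 //.
by apply: le_trans lex _; rewrite -natrX ler_nat ltn_expl.
Qed.

(* Number of applications of log2, starting from n, until the value is <= 1.
   All values before the last one exceed 1, so the totalised value of ln on
   nonpositive reals plays no role. *)
Definition log_star (n : nat) : nat := ex_minn (ex_log_star n).

End IteratedLogarithm.

Section Circuits.
Variable m : nat.

Definition bits := {ffun 'I_m -> bool}.

(* The Clifford gates are the standard generators H, S, CNOT of the Clifford
   group.  Every one- or two-qubit Clifford gate is, up to a global phase, a
   product of boundedly many of them (e.g. X = H S S H), so another choice of
   one- and two-qubit Clifford gates changes the depth by a constant factor only
   and leaves the Toffoli count unchanged. *)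
Inductive gate :=
  | Hadamard (q : 'I_m)
  | Phase (q : 'I_m)
  | CNOT (c t : 'I_m) of c != t
  | Toffoli (x y z : 'I_m) of uniq [:: x; y; z].

Definition gate_qubits (g : gate) : {set 'I_m} :=
  match g with
  | Hadamard q => [set q]
  | Phase q => [set q]
  | CNOT c t _ => [set c; t]
  | Toffoli x y z _ => [set x; y; z]
  end.

Definition is_toffoli (g : gate) : bool :=
  if g is Toffoli _ _ _ _ then true else false.

(* The gates in order of application. *)
Definition circuit := seq gate.

Definition toffoli_count (c : circuit) : nat := count is_toffoli c.

Definition layering (c : circuit) (d : nat)
    (l : {ffun 'I_(size c) -> 'I_d}) : bool :=
  [forall i : 'I_(size c), forall j : 'I_(size c), (i < j)%N ==>
    ~~ [disjoint gate_qubits (tnth (in_tuple c) i)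
              & gate_qubits (tnth (in_tuple c) j)] ==>
    ((l i <= l j)%N && (l i != l j))].

Lemma ex_layering (c : circuit) :
  exists d, [exists l : {ffun 'I_(size c) -> 'I_d}, layering l].
Proof.
exists (size c); apply/existsP; exists [ffun i => i].
apply/forallP => i; apply/forallP => j; apply/implyP => ltij.
by apply/implyP => _; rewrite !ffunE ltnW //= neq_ltn ltij.
Qed.

Definition depth (c : circuit) : nat := ex_minn (ex_layering c).

Section Semantics.
Variable K : numClosedFieldType.

(* The (not necessarily normalised) states of m qubits. *)
Definition state := {ffun bits -> K^o}.

Definition ket (b : bits) : state := [ffun b' => (b' == b)%:R].

Definition set_bit (b : bits) (q : 'I_m) (v : bool) : bits :=
  [ffun i => if i == q then v else b i].

Definition gate_ket (g : gate) (b : bits) : state :=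
  match g with
  | Hadamard q => (sqrtC 2)^-1 *:
      (ket (set_bit b q false) + (-1) ^+ b q *: ket (set_bit b q true))
  | Phase q => 'i ^+ b q *: ket b
  | CNOT c t _ => ket (set_bit b t (b t (+) b c))
  | Toffoli x y z _ => ket (set_bit b z (b z (+) (b x && b y)))
  end.

(* Linear extension of gate_ket. *)
Definition gate_apply (g : gate) (psi : state) : state :=
  \sum_b psi b *: gate_ket g b.

Definition run (c : circuit) (psi : state) : state :=
  foldl (fun phi g => gate_apply g phi) psi c.

End Semantics.

End Circuits.

(* The basis vector |x>|0...0> of n register qubits, holding x in binary with
   qubit i of weight 2 ^ i, followed by a ancilla qubits. *)
Definition register_bits (n a x : nat) : bits (n + a) :=
  [ffun q => match split q with
             | inl i => odd (x %/ 2 ^ i)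
             | inr _ => false
             end].

Definition register_ket (K : numClosedFieldType) (n a x : nat) :
    state (n + a) K :=
  ket K (register_bits n a x).

(* Both sides being linear, agreement on the |x>|0...0> is agreement on all
   superpositions of them; the right-hand side returns the ancillas to 0. *)
Definition implements_incrementer (K : numClosedFieldType) (n a : nat)
    (c : circuit (n + a)) : Prop :=
  forall x : nat, (x < 2 ^ n)%N ->
    run c (register_ket K n a x) = register_ket K n a ((x + 1) %% 2 ^ n)%N.

(* Main.v *)
Require Import Defs.
From mathcomp Require Import all_boot all_order all_algebra.
From mathcomp Require Import reals exp.
From mathcomp Require Import zify.

(* A qubit that is 0 whenever some control c is 1 ("conditionally clean") can
   hold an intermediate AND: if c = 0 it contains garbage, which is uncomputed
   anyway and cannot leak as long as every flip of a register bit is also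
   controlled by c.  Given K conditionally clean qubits F and one clean ancilla
   d, the bits above c are cut into blocks.  A qubit a of F holds the AND of the
   bits already passed; when c = a = 1, those bits, and the qubits used to
   process them, have known values and so become conditionally clean: the
   supply doubles with each block, one qubit of F being used up as the next a.
   After K blocks, d = c && a is a true control with 2^K conditionally clean
   qubits, and the next clean ancilla starts over with K replaced by 2^K.  Hence
   log* n ancillas suffice.

   A block of s bits costs s - 1 Toffoli gates to compute its partial ANDs, s - 1
   to uncompute them, s - 1 to flip its bits (the lowest one takes a CNOT), two
   for the next a, and one to pass d from one block to the preceding one: 3s in
   all.  The depth is bounded by the number of gates. *)

Set Implicit Arguments.
Unset Strict Implicit.
Unset Printing Implicit Defensive.

Import Order.TTheory GRing.Theory Num.Theory.
Local Open Scope ring_scope.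

Lemma uniq_countP (T : eqType) (s : seq T) :
  uniq s <-> forall x, (count_mem x s <= 1)%N.
Proof.
split=> [us x|]; first by rewrite count_uniq_mem // leq_b1.
elim: s => //= y s IHs cnt; rewrite IHs ?andbT => [|x].
  by have /= := cnt y; rewrite eqxx add1n ltnS leqn0 => /eqP/count_memPn.
by apply: leq_trans (cnt x); rewrite leq_addl.
Qed.

(** * Reversible circuits *)

Section Reversible.
Variable m : nat.
Implicit Types (b : bits m) (q : 'I_m) (e : bool) (S W G Z : seq 'I_m).

(* [(s, t)] is the NOT of [t] controlled by all qubits of [s]. *)
Definition rgate := (seq 'I_m * 'I_m)%type.
Implicit Types (g : rgate) (C : seq rgate).

Definition flip e q b : bits m := set_bit b q (b q (+) e).

Definition exec_gate g b : bits m := flip (all b g.1) g.2 b.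

Definition exec C b : bits m := foldl (fun b' g => exec_gate g b') b C.

Definition avoids q C := all (fun g => q \notin g.2 :: g.1) C.

(** The target differs from the controls, so the gate is its own inverse; at most two controls leave
    only NOT, CNOT and Toffoli. *)
Definition rgate_wf g := uniq (g.2 :: g.1) && (size g.1 <= 2)%N.

(* Increment of [Z], least significant bit first, with carry-in [e]. *)
Fixpoint cinc e Z b : bits m :=
  if Z is z :: Z' then flip e z (cinc (e && b z) Z' b) else b.

Definition zero b S := forall q, q \in S -> b q = false.

Lemma flipE e q b q' : flip e q b q' = b q' (+) ((q' == q) && e).
Proof. by rewrite ffunE; case: eqP => [->|]; rewrite ?addbF. Qed.

Lemma flip_id q b : flip false q b = b.
Proof. by apply/ffunP => q'; rewrite flipE andbF addbF. Qed.

Lemma flip_flip e e' q b : flip e q (flip e' q b) = flip (e (+) e') q b.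
Proof.
by apply/ffunP => q'; rewrite !flipE; case: (q' == q); case: (b q') e e' => -[] [].
Qed.

Lemma flipC e e' q q' b : flip e q (flip e' q' b) = flip e' q' (flip e q b).
Proof.
apply/ffunP => x; rewrite !flipE.
by case: (b x) (_ && e) (_ && e') => -[] [].
Qed.

Lemma all_flip e q b S : q \notin S -> all (flip e q b) S = all b S.
Proof.
move=> qS; apply: eq_in_all => x xS; rewrite flipE.
by case: eqP => [xq|]; rewrite ?addbF //; rewrite -xq xS in qS.
Qed.

Lemma exec_cat C C' b : exec (C ++ C') b = exec C' (exec C b).
Proof. exact: foldl_cat. Qed.

Lemma exec_cons g C b : exec (g :: C) b = exec C (exec_gate g b).
Proof. by []. Qed.

Lemma exec_flip e q C b :
  avoids q C -> exec C (flip e q b) = flip e q (exec C b).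
Proof.
elim: C b => //= g C IHC b /andP[qg qC]; rewrite -IHC //; congr exec.
rewrite /exec_gate all_flip; first by rewrite flipC.
by apply: contra qg; rewrite inE => ->; rewrite orbT.
Qed.

Lemma exec_avoids q C b : avoids q C -> exec C b q = b q.
Proof.
elim: C b => //= g C IHC b /andP[qg qC]; rewrite IHC // flipE.
by rewrite inE negb_or in qg; case/andP: qg => /negPf-> _; rewrite addbF.
Qed.

(** [C] neither reads nor writes [Z], and the carries inside [Z] depend only on [e] and [Z]. This
    lets an uncomputation be moved past the increment of the higher bits. *)
Lemma exec_cinc e Z C b :
  {in Z, forall q, avoids q C} -> exec C (cinc e Z b) = cinc e Z (exec C b).
Proof.
elim: Z e => //= z Z IHZ e ZC; rewrite exec_flip ?ZC ?mem_head //.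
rewrite IHZ => [|q qZ]; last by apply: ZC; rewrite inE qZ orbT.
by rewrite exec_avoids // ZC ?mem_head.
Qed.

Lemma exec_rev C b : all rgate_wf C -> exec (rev C) (exec C b) = b.
Proof.
elim: C b => //= g C IHC b /andP[wfg wfC].
rewrite rev_cons -cats1 exec_cat IHC //= /exec_gate.
have /andP[/= /andP[tg _] _] := wfg.
by rewrite all_flip // flip_flip addbb flip_id.
Qed.

Lemma cincE e Z b q : uniq Z ->
  cinc e Z b q = b q (+) [&& q \in Z, e & all b (take (index q Z) Z)].
Proof.
elim: Z e => [|z Z IHZ] e; first by rewrite addbF.
move=> /=/andP[zZ uZ]; rewrite flipE IHZ // inE eq_sym.
case: (z =P q) => [<-|_] /=; first by rewrite (negPf zZ) addbF andbT.
by rewrite addbF; case: (q \in Z); case: e.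
Qed.

Lemma cinc_notin e Z b q : q \notin Z -> cinc e Z b q = b q.
Proof.
elim: Z e => //= z Z IHZ e; rewrite inE negb_or => /andP[/negPf qz qZ].
by rewrite flipE qz addbF IHZ.
Qed.

(** The upper part goes first, while [W] still has the values that determine the carry out of it.
    This splits an increment into blocks. *)
Lemma cinc_cat e W Z b : uniq (W ++ Z) ->
  cinc e (W ++ Z) b = cinc e W (cinc (e && all b W) Z b).
Proof.
elim: W e => [|w W IHW] e; first by rewrite andbT.
rewrite /= mem_cat negb_or -andbA => /and3P[_ wZ uWZ].
by rewrite IHW // cinc_notin // andbA.
Qed.

Lemma cinc_flip e e' Z q b : q \notin Z ->
  cinc e Z (flip e' q b) = flip e' q (cinc e Z b).
Proof.
elim: Z e => //= z Z IHZ e; rewrite inE negb_or => /andP[qz qZ].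
by rewrite IHZ // flipC flipE eq_sym (negPf qz) addbF.
Qed.

End Reversible.

(* From [u : uniq s], proves that a list is duplicate-free or that qubits do not
   occur in a list, by comparing multiplicities. *)
Ltac fresh_qubit u :=
  let x := fresh "x" in
  let h := fresh "h" in
  let xS := fresh "xS" in
  have h := iffLR (uniq_countP _) u;
  lazymatch goal with
  | |- is_true (uniq _) => apply/uniq_countP => x; move: (h x)
  | |- is_true (?q \notin _) => apply/count_memPn; move: (h q)
  | |- _ => move=> x; rewrite -has_pred1 has_count => xS;
      apply/count_memPn; move: xS (h x)
  end;
  clear; repeat (progress (rewrite ?count_cat /= ?eqxx));
  repeat match goal with
  | |- context [nat_of_bool ?e] => move: (nat_of_bool e) => ?
  end;
  repeat match goal with
  | |- context [count ?p ?s] => move: (count p s) => ?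
  end;
  lia.

(** * Ladders of partial ANDs *)

Section Ladder.
Variable m : nat.
Implicit Types (b : bits m) (q p c d a : 'I_m) (ps S W G Z : seq 'I_m).
Implicit Types (C : seq (rgate m)).

(** [ps] is empty or holds the preceding carry. If [G] starts at 0, its entries become the ANDs of
    [ps] with the successive prefixes of [W]. *)
Fixpoint carry_up ps W G : seq (rgate m) :=
  match W, G with
  | w :: W', g :: G' => (w :: ps, g) :: carry_up [:: g] W' G'
  | _, _ => [::]
  end.

(** Higher bits come first: each [g] is uncomputed after its last use as a carry and before [w],
    from which it was computed, is flipped. *)
Fixpoint carry_down c ps W G : seq (rgate m) :=
  match W, G with
  | w :: W', g :: G' =>
      carry_down c [:: g] W' G' ++ [:: (w :: ps, g); (c :: ps, w)]
  | _, _ => [::]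
  end.

Definition fan p S : seq (rgate m) := [seq ([:: p], s) | s <- S].

Lemma all_cinc e Z b S :
  {in S, forall q, q \notin Z} -> all (cinc e Z b) S = all b S.
Proof. by move=> SZ; apply: eq_in_all => q /SZ qZ; apply: cinc_notin. Qed.

Lemma exec_nontarget q C b : q \notin map snd C -> exec C b q = b q.
Proof.
elim: C b => //= g C IHC b; rewrite inE negb_or => /andP[/negPf qg qC].
by rewrite IHC // flipE qg addbF.
Qed.

Lemma carry_up_target ps W G q :
  q \notin G -> q \notin map snd (carry_up ps W G).
Proof.
elim: W G ps => [|w W IHW] [|g G] ps //=; rewrite !inE !negb_or.
by case/andP=> -> qG; apply: IHW.
Qed.

Lemma avoids_carry_up ps W G q :
  q \notin ps ++ W ++ G -> avoids q (carry_up ps W G).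
Proof.
elim: W G ps => [|w W IHW] [|g G] ps //=.
rewrite !(mem_cat, inE) !negb_or -!andbA => /and5P[qps qw qW qg qG].
by rewrite qps qw qg IHW //= !(mem_cat, inE) !negb_or qg qW.
Qed.

Lemma avoids_fan p S q : q \notin p :: S -> avoids q (fan p S).
Proof.
elim: S => //= s S IHS; rewrite !inE !negb_or => /and3P[qp qs qS].
by rewrite qp qs IHS //= inE negb_or qp.
Qed.

Lemma exec_fan p S b q :
  uniq (p :: S) -> exec (fan p S) b q = b q (+) ((q \in S) && b p).
Proof.
elim: S b => [|s S IHS] b; first by rewrite addbF.
rewrite /= inE negb_or -andbA => /and4P[/negPf ps pS sS uS].
rewrite IHS /= ?pS // !flipE ps /= andbT inE addbF.
case: (q =P s) => [->|_] /=; first by rewrite (negPf sS) /= addbF.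
by rewrite addbF.
Qed.

(** If [c] is 0, no bit of [W] changes, so every gate onto [G] is applied twice with the same
    controls and the garbage in [G] survives. If [c] is 1, [G] is 0 and holds true carries. *)
Lemma carry_downK c ps W G b :
  (size W <= size G)%N -> uniq (c :: ps ++ W ++ G) -> (b c -> zero b G) ->
  exec (carry_down c ps W G) (exec (carry_up ps W G) b)
    = cinc (b c && all b ps) W b.
Proof.
elim: W G ps b => [|w W IHW] [|g G] ps b sWG u G0 //.
rewrite [carry_up _ _ _]/= [carry_down _ _ _ _]/= exec_cons.
have gc : g \notin [:: c] by fresh_qubit u.
have gps : g \notin w :: ps by fresh_qubit u.
have gW : g \notin W by fresh_qubit u.
have gG : g \notin G by fresh_qubit u.
have wcps : w \notin c :: ps by fresh_qubit u.
have wpsW : {in w :: ps, forall q, q \notin W} by fresh_qubit u.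
set e := all b (w :: ps).
have b1c : exec_gate (w :: ps, g) b c = b c.
  by rewrite flipE eq_sym -mem_seq1 (negPf gc) addbF.
rewrite exec_cat IHW //; first last.
- rewrite b1c => bc q qG; rewrite flipE; case: eqP => [/= qg|_].
    by rewrite -qg qG in gG.
  by rewrite addbF G0 // inE qG orbT.
- by fresh_qubit u.
rewrite [all _ [:: g]]/= andbT b1c {2}/exec_gate -/e flipE eqxx [_ && e]/=.
(* This is the use of conditional cleanness: the garbage in [g] is masked by [c]. *)
have -> : b c && (b g (+) e) = b c && all b ps && b w.
  by case bc: (b c) => //=; rewrite G0 ?mem_head //= andbC.
rewrite /exec_gate /= cinc_flip // -/e.
set s := cinc _ W b.
(* The increment above leaves [w :: ps] alone, so the second gate onto [g] cancels the first. *)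
have swps : all s (w :: ps) = e by rewrite all_cinc.
have scps : all s (c :: ps) = b c && all b ps.
  by rewrite all_cinc //; fresh_qubit u.
rewrite {2}/exec_gate [fst _]/= [snd _]/=.
rewrite (all_flip _ _ gps) swps flip_flip addbb flip_id.
by rewrite /exec_gate [fst _]/= [snd _]/= scps.
Qed.

Lemma carry_up_last_cons ps w W g G b :
  size W = size G -> uniq (ps ++ (w :: W) ++ g :: G) -> zero b (g :: G) ->
  exec (carry_up ps (w :: W) (g :: G)) b (last g G)
    = all b ps && all b (w :: W).
Proof.
elim: W ps w g G b => [|w' W IHW] ps w g [|g' G] b // sWG u G0.
  by rewrite /= flipE eqxx G0 ?mem_head //= andbT andbC.
case: sWG => sWG.
have gw : g \notin w' :: W by fresh_qubit u.
have gG : g \notin g' :: G by fresh_qubit u.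
rewrite [carry_up _ _ _]/= exec_cons [last _ _]/= IHW //; first last.
- move=> q qG; rewrite flipE; case: eqP => [/= qg|_].
    by rewrite -qg qG in gG.
  by rewrite addbF G0 // inE qG orbT.
- by fresh_qubit u.
rewrite (all_flip _ _ gw) [all _ [:: g]]/= flipE eqxx G0 ?mem_head //=.
by rewrite andbT -andbA andbCA.
Qed.

Lemma carry_up_last ps W G x b :
  size W = size G -> (0 < size G)%N -> uniq (ps ++ W ++ G) -> zero b G ->
  exec (carry_up ps W G) b (last x G) = all b ps && all b W.
Proof.
by case: W G => [|w W] [|g G] // [sWG] _; apply: carry_up_last_cons.
Qed.

Lemma fan_wf p S : p \notin S -> all (@rgate_wf m) (fan p S).
Proof.
move=> pS; rewrite /fan all_map; apply/allP => s sS.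
by rewrite /= /rgate_wf /= inE !andbT; apply: contraNneq pS => <-.
Qed.

(** Needed for the fan in [link]: it can clear [G] only if every partial AND is 1, not just the last
    one. *)
Lemma carry_up_ones ps W G b :
  size W = size G -> uniq (ps ++ W ++ G) -> zero b G ->
  all b ps -> all b W -> {in G, forall q, exec (carry_up ps W G) b q}.
Proof.
elim: W ps G b => [|w W IHW] ps [|g G] b // sWG u G0 bps.
case: sWG => sWG /andP[bw bW] q.
have gw : g \notin W by fresh_qubit u.
have gG : g \notin G by fresh_qubit u.
have b1g : exec_gate (w :: ps, g) b g.
  by rewrite /exec_gate flipE /= bw bps eqxx G0 ?mem_head.
rewrite [carry_up _ _ _]/= exec_cons inE => /predU1P[->|qG]; last first.
  apply: IHW qG => //; [by fresh_qubit u| |by rewrite /= b1g|].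
    move=> q' qG; rewrite flipE; case: eqP => [/= qg|_].
      by rewrite -qg qG in gG.
    by rewrite addbF G0 // inE qG orbT.
  by rewrite /exec_gate (all_flip _ _ gw).
by rewrite exec_nontarget ?carry_up_target.
Qed.

End Ladder.

(** * Growing the supply of conditionally clean qubits *)

Section Block.
Variables (m : nat) (inner : seq 'I_m -> seq 'I_m -> seq (rgate m)).
Variables (c d : 'I_m) (A : seq 'I_m).
Implicit Types (b : bits m) (a q : 'I_m) (F G W Z : seq 'I_m).

(* Both [block] and [block_stop] increment [Z] controlled by [c && a], where [G]
   is 0 if [c && a] and [Fa] is 0 if [c].  They turn [d] from 0 into [c && a]
   instead of restoring it: the caller then moves [d] to its own control with a
   single Toffoli gate. *)
Definition block_stop a G Z : seq (rgate m) :=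
  ([:: c; a], d) :: ([:: d], a) :: inner (a :: G) Z ++ [:: ([:: d], a)].

(* Given [c], this sets [a'] to the AND of [a] and [W]; the fan then clears [a],
   [W] and [G], which are all 1 if [a'] is. *)
Definition link a (a' : 'I_m) W G : seq (rgate m) :=
  ([:: a; last a G], a') :: fan a' (a :: W ++ G).

Fixpoint block a G Fa Z : seq (rgate m) :=
  if Fa is a' :: Fa' then
    if (size Z <= size G)%N then block_stop a G Z else
    let W := take (size G) Z in
    carry_up [::] W G ++ link a a' W G
      ++ block a' (a :: W ++ G) Fa' (drop (size G) Z)
      ++ ([:: c; a], d) :: rev (link a a' W G) ++ carry_down d [::] W G
  else block_stop a G Z.

Lemma block_cons a a' G Fa Z :
  block a G (a' :: Fa) Z =
    if (size Z <= size G)%N then block_stop a G Z else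
    let W := take (size G) Z in
    carry_up [::] W G ++ link a a' W G
      ++ block a' (a :: W ++ G) Fa (drop (size G) Z)
      ++ ([:: c; a], d) :: rev (link a a' W G) ++ carry_down d [::] W G.
Proof. by []. Qed.

Lemma link_wf a a' W G :
  (0 < size G)%N -> uniq (a' :: a :: W ++ G) -> all (@rgate_wf m) (link a a' W G).
Proof.
move=> sG u.
have lG : last a G \in G by case: (G) sG => //= g G1 _; apply: mem_last.
have a'M : a' \notin a :: W ++ G by fresh_qubit u.
have aU : a \notin W ++ G by fresh_qubit u.
rewrite /link -[_ :: fan _ _]cat1s all_cat all_seq1 fan_wf // andbT.
have a'l : a' != last a G.
  by apply: contraNneq a'M => ->; rewrite inE mem_cat lG !orbT.
have al : a != last a G by apply: contraNneq aU => ->; rewrite mem_cat lG orbT.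
have a'a : a' != a by apply: contraNneq a'M => ->; rewrite mem_head.
by rewrite /rgate_wf /= !inE negb_or a'a a'l al.
Qed.

Lemma leq_iter_exp2 k x : (x <= iter k (expn 2) x)%N.
Proof. by elim: k => //= k /leq_trans; apply; rewrite ltnW // ltn_expl. Qed.

Lemma avoids_cons q g (C : seq (rgate m)) :
  avoids q (g :: C) = (q \notin g.2 :: g.1) && avoids q C.
Proof. by []. Qed.

Lemma zero_flip e q b S : q \notin S -> zero b S -> zero (flip e q b) S.
Proof.
move=> qS S0 q' q'S; rewrite flipE S0 //.
by case: eqP q'S qS => // -> ->.
Qed.

Hypothesis innerE : forall F Z b,
  uniq (d :: F ++ A ++ Z) -> (0 < size F)%N ->
  (size Z <= iter (size A) (expn 2) (size F))%N ->
  zero b A -> (b d -> zero b F) ->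
  exec (inner F Z) b = cinc (b d) Z b.

(** Once [d] is [c && a], the CNOT from [d] clears [a] whenever [d] is 1, so [a :: G] is clean
    conditionally on [d]. As [inner] changes neither [a] nor [d], the second CNOT restores [a]. *)
Lemma block_stopE a G Z b :
  uniq (c :: d :: a :: G ++ A ++ Z) ->
  (size Z <= iter (size A) (expn 2) (size G).+1)%N ->
  b d = false -> zero b A -> (b c && b a -> zero b G) ->
  exec (block_stop a G Z) b
    = flip (b c && b a) d (cinc (b c && b a) Z b).
Proof.
move=> u sZ d0 A0 G0; set e := b c && b a.
have ad : a \notin [:: d] by fresh_qubit u.
have aAZ : a \notin A ++ G ++ Z by fresh_qubit u.
have dAZ : d \notin A ++ G ++ Z by fresh_qubit u.
move: aAZ dAZ ad; rewrite !mem_cat !inE !negb_or.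
case/and3P=> aA aG aZ /and3P[dA dG dZ] /negPf ad.
rewrite /block_stop !exec_cons exec_cat {2}/exec_gate /= andbT -/e.
rewrite {2}/exec_gate /= flipE d0 eqxx /= andbT.
set s := flip e a _.
have sd : s d = e by rewrite !flipE eqxx eq_sym ad d0 addbF.
rewrite innerE //; first last.
- rewrite sd => e1 q; rewrite inE => /predU1P[->|].
    by rewrite !flipE eqxx ad /= addbF e1; case/andP: e1 => _ ->.
  by apply: zero_flip => //; apply: zero_flip => //; apply: G0.
- by apply: zero_flip => //; apply: zero_flip.
- by fresh_qubit u.
rewrite sd /exec_gate /= cinc_notin // sd andbT /s !cinc_flip //.
by rewrite flip_flip addbb flip_id.
Qed.

(** The quantity [(size G).+1] doubles at each recursive call, whose new supply is [a :: W ++ G]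
    with [size W = size G]; this gives the factor [2 ^ size Fa]. *)
Lemma blockE a G Fa Z b :
  uniq (c :: d :: a :: G ++ Fa ++ A ++ Z) -> (0 < size G)%N ->
  (size Z <= iter (size A) (expn 2) ((size G).+1 * 2 ^ size Fa))%N ->
  b d = false -> zero b A -> (b c -> zero b Fa) ->
  (b c && b a -> zero b G) ->
  exec (block a G Fa Z) b
    = flip (b c && b a) d (cinc (b c && b a) Z b).
Proof.
elim: Fa a G Z b => [|a' Fa IH] a G Z b u sG sZ d0 A0 Fa0 G0.
  by apply: block_stopE => //; rewrite muln1 in sZ.
rewrite block_cons; case: leqP => sZG.
  (* Stopping early is safe: a [Z] no longer than [G] fits, since the tower function is at least its
     argument. *)
  apply: block_stopE => //; first by fresh_qubit u.
  by apply: leq_trans (leq_iter_exp2 _ _); apply: leqW.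
cbv zeta; set W := take _ Z; set Z' := drop _ Z; set mid := link _ _ _ _.
have ZE : Z = W ++ Z' by rewrite cat_take_drop.
have sW : size W = size G by rewrite size_take sZG.
rewrite ZE in u sZ *.
set E := b c && b a.
have cU : c \notin [::] ++ W ++ G by fresh_qubit u.
have dU : d \notin [::] ++ W ++ G by fresh_qubit u.
have aU : a \notin [::] ++ W ++ G by fresh_qubit u.
have a'U : a' \notin [::] ++ W ++ G by fresh_qubit u.
have FaU : {in Fa, forall q, q \notin [::] ++ W ++ G} by fresh_qubit u.
have AU : {in A, forall q, q \notin [::] ++ W ++ G} by fresh_qubit u.
have Z'U : {in Z', forall q, q \notin [::] ++ W ++ G} by fresh_qubit u.
have a'M : a' \notin a :: W ++ G by fresh_qubit u.
have lG : last a G \in G by case: (G) sG => //= g G1 _; apply: mem_last.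
have M q : q \notin a' :: a :: W ++ G -> avoids q mid.
  move=> qM; rewrite /mid avoids_cons avoids_fan // andbT.
  move: qM; rewrite /= !inE !mem_cat !negb_or.
  by case/and4P=> -> -> _ qG /=; apply: contraNneq qG => ->.
have cM : avoids c mid by apply: M; fresh_qubit u.
have dM : avoids d mid by apply: M; fresh_qubit u.
have FaM : {in Fa, forall q, avoids q mid}.
  suff H : {in Fa, forall q, q \notin a' :: a :: W ++ G} by move=> q /H/M.
  by fresh_qubit u.
have AM : {in A, forall q, avoids q mid}.
  suff H : {in A, forall q, q \notin a' :: a :: W ++ G} by move=> q /H/M.
  by fresh_qubit u.
have Z'M : {in Z', forall q, avoids q mid}.
  suff H : {in Z', forall q, q \notin a' :: a :: W ++ G} by move=> q /H/M.
  by fresh_qubit u.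
have umid : uniq (a' :: a :: W ++ G) by fresh_qubit u.
have wfmid : all (@rgate_wf m) mid by apply: link_wf.
rewrite exec_cat; set t := exec (carry_up _ _ _) b.
have tE q : q \notin [::] ++ W ++ G -> t q = b q.
  by move=> qU; apply/exec_avoids/avoids_carry_up.
have last_t : E -> t (last a G) = all b W.
  by move=> e1; rewrite carry_up_last //; [fresh_qubit u | apply: G0].
rewrite exec_cat; set s := exec mid t.
pose s0 := exec_gate ([:: a; last a G], a') t.
have sE q : s q = s0 q (+) ((q \in a :: W ++ G) && s0 a').
  by rewrite /s /mid /link exec_cons exec_fan.
have s0a' : s0 a' = b a' (+) (b a && t (last a G)).
  by rewrite flipE eqxx /= (tE a') // (tE a) // andbT.
have s0E q : q != a' -> s0 q = t q.
  by rewrite flipE => /negPf->; rewrite addbF.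
have ss0a' : s a' = s0 a' by rewrite sE (negPf a'M) addbF.
(* Under [c], [a'] starts at 0, so [link] makes it the new carry; otherwise its value is masked. *)
have sa' : b c && s a' = E && all b W.
  rewrite ss0a' s0a'; rewrite /E in last_t *.
  case bc: (b c) => //=; rewrite Fa0 ?mem_head //=.
  by case ba: (b a) => //=; rewrite last_t ?bc ?ba.
have sa : s a = b a (+) s a'.
  rewrite ss0a' sE mem_head s0E ?tE //.
  by apply: contraNneq a'M => <-; rewrite mem_head.
have sc : s c = b c by rewrite /s exec_avoids // tE.
rewrite exec_cat IH //; first last.
(* When the next control is 1, [a], [W] and [G] are all 1 before the fan, and the fan turns them to
   0. *)
- rewrite sc sa' => /andP[e1 bW] q qM; rewrite sE qM.
  have -> : s0 a' = true.
    by move: sa'; rewrite -ss0a' e1 bW; case/andP: e1 => -> _.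
  rewrite s0E; last by apply: contraNneq a'M => <-.
  rewrite addbT; apply/negbTE; rewrite negbK; move: qM; rewrite inE mem_cat.
  case/or3P => [/eqP->|qW|qG].
  + by rewrite tE //; case/andP: e1.
  + rewrite /t exec_nontarget ?(allP bW) //; apply: carry_up_target.
    by move: q qW; fresh_qubit u.
  + by apply: carry_up_ones => //; [fresh_qubit u | apply: G0].
- by rewrite sc => bc q qFa; rewrite /s exec_avoids ?FaM // tE ?FaU // Fa0 // inE qFa orbT.
- by move=> q qA; rewrite /s exec_avoids ?AM // tE ?AU // A0.
- by rewrite /s exec_avoids // tE.
- apply: leq_trans (leq_trans _ sZ) _; first by rewrite size_cat leq_addl.
  by rewrite /= size_cat sW expnS mulnA addnn -doubleS -muln2.
- by fresh_qubit u.
rewrite exec_cons exec_cat sc sa'.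
(* Under [c], [d] holds [s a'] while [a] holds [b a (+) s a'] because of the fan. Adding them
   cancels [s a'], so a single Toffoli turns [d] into [c && a]. *)
have -> : exec_gate ([:: c; a], d) (flip (E && all b W) d (cinc (E && all b W) Z' s))
   = flip E d (cinc (E && all b W) Z' s).
  set e' := E && _; rewrite /exec_gate flip_flip; congr flip.
  have cdZ' : c \notin d :: Z' by fresh_qubit u.
  have adZ' : a \notin d :: Z' by fresh_qubit u.
  move: cdZ' adZ'; rewrite !inE !negb_or.
  case/andP=> /negPf cd cZ' /andP[/negPf ad aZ'].
  rewrite /= !flipE cd ad !cinc_notin // !addbF sc sa /e' -sa' /E.
  by case: (b c) (b a) (s a') => -[] [].
rewrite exec_flip; last by rewrite /avoids all_rev.
rewrite exec_cinc; last by move=> q /Z'M; rewrite /avoids all_rev.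
(* Moving [carry_up] past the increment of [Z'] and the flip of [d] brings it next to [carry_down],
   whose control is now [d]. *)
rewrite exec_rev // -exec_cinc; last by move=> q /Z'U/avoids_carry_up.
rewrite -exec_flip; last exact: avoids_carry_up.
rewrite carry_downK //; first last.
- rewrite flipE eqxx cinc_notin ?d0; last by fresh_qubit u.
  move=> e1; apply: zero_flip => [|q qG].
    by apply: contra dU; rewrite !mem_cat => ->; rewrite !orbT.
  rewrite cinc_notin; first exact: G0.
  by move: q qG; fresh_qubit u.
- by fresh_qubit u.
- by rewrite sW.
rewrite [all _ [::]]/= andbT flipE eqxx cinc_notin; last by fresh_qubit u.
rewrite d0 /= cinc_flip; last by fresh_qubit u.
by rewrite cinc_cat //; fresh_qubit u.
Qed.

End Block.

(** * The controlled incrementer and its cost *)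

Section Cost.
Variable m : nat.
Implicit Types (ps F G W Z : seq 'I_m) (C : seq (rgate m)).

Definition ntof C := count (fun g => size g.1 == 2)%N C.

Lemma ntof_cat C C' : ntof (C ++ C') = (ntof C + ntof C')%N.
Proof. exact: count_cat. Qed.

Lemma ntof_cons g C : ntof (g :: C) = ((size g.1 == 2) + ntof C)%N.
Proof. by []. Qed.

Lemma wf_cons g C :
  all (@rgate_wf m) (g :: C) = rgate_wf g && all (@rgate_wf m) C.
Proof. by []. Qed.

Lemma ntof_rev C : ntof (rev C) = ntof C.
Proof. exact: count_rev. Qed.

Lemma ntof_fan p Z : ntof (fan p Z) = 0%N.
Proof. by elim: Z. Qed.

Lemma size_fan p Z : size (fan p Z) = size Z.
Proof. exact: size_map. Qed.

Lemma ntof_carry_up1 p W G : (ntof (carry_up [:: p] W G) <= size W)%N.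
Proof. by elim: W p G => [|w W IH] p [|g G] //=; rewrite ltnS. Qed.

(** With no incoming carry the lowest gate is a CNOT, which saves one Toffoli; in [carry_down] it
    saves two. *)
Lemma ntof_carry_up W G : (ntof (carry_up [::] W G) <= (size W).-1)%N.
Proof. by case: W G => [|w W] [|g G] //=; rewrite ntof_carry_up1. Qed.

Lemma ntof_carry_down1 c p W G :
  (ntof (carry_down c [:: p] W G) <= (size W).*2)%N.
Proof.
elim: W p G => [|w W IH] p [|g G] //=.
by rewrite ntof_cat; have := IH g G; rewrite !ntof_cons /=; lia.
Qed.

Lemma ntof_carry_down c W G :
  (ntof (carry_down c [::] W G) <= (size W).-1.*2)%N.
Proof.
case: W G => [|w W] [|g G] //=.
by rewrite ntof_cat !ntof_cons /= !addn0 ntof_carry_down1.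
Qed.

Lemma size_carry_up ps W G : (size (carry_up ps W G) <= size W)%N.
Proof. by elim: W ps G => [|w W IH] ps [|g G] //=; rewrite ltnS. Qed.

Lemma size_carry_down c ps W G :
  (size (carry_down c ps W G) <= (size W).*2)%N.
Proof.
elim: W ps G => [|w W IH] ps [|g G] //=.
by rewrite size_cat /=; have := IH [:: g] G; lia.
Qed.

Lemma carry_up_wf ps W G :
  (size ps <= 1)%N -> uniq (ps ++ W ++ G) -> all (@rgate_wf m) (carry_up ps W G).
Proof.
elim: W ps G => [|w W IH] ps [|g G] // sps u.
rewrite [carry_up _ _ _]/= [all _ _]/=; apply/andP; split.
  by apply/andP; split; [fresh_qubit u|].
by apply: IH => //; fresh_qubit u.
Qed.

Lemma carry_down_wf c ps W G :
  (size ps <= 1)%N -> uniq (c :: ps ++ W ++ G) ->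
  all (@rgate_wf m) (carry_down c ps W G).
Proof.
elim: W ps G => [|w W IH] ps [|g G] // sps u.
rewrite [carry_down _ _ _ _]/= all_cat; apply/andP; split.
  by apply: IH => //; fresh_qubit u.
rewrite [all _ _]/= andbT; apply/andP; split; apply/andP; split => //.
  by fresh_qubit u.
by fresh_qubit u.
Qed.

(** * Cost of a block *)

Section Block.
Variable inner : seq 'I_m -> seq 'I_m -> seq (rgate m).
Variables (c d : 'I_m) (A : seq 'I_m).

Hypothesis inner_wf : forall F Z,
  uniq (d :: F ++ A ++ Z) -> all (@rgate_wf m) (inner F Z).
Hypothesis inner_ntof : forall F Z, (ntof (inner F Z) <= 3 * size Z)%N.
Hypothesis inner_size : forall F Z, (size (inner F Z) <= 12 * size Z)%N.

Lemma block_stop_wf a G Z :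
  uniq (c :: d :: a :: G ++ A ++ Z) ->
  all (@rgate_wf m) (block_stop inner c d a G Z).
Proof.
move=> u; have da : rgate_wf ([:: d], a).
  by apply/andP; split=> //; fresh_qubit u.
rewrite /block_stop [all _ _]/= da all_cat all_seq1 da inner_wf; last by fresh_qubit u.
by rewrite !andbT; apply/andP; split=> //; fresh_qubit u.
Qed.

Lemma block_wf a G Fa Z :
  uniq (c :: d :: a :: G ++ Fa ++ A ++ Z) -> (0 < size G)%N ->
  all (@rgate_wf m) (block inner c d a G Fa Z).
Proof.
elim: Fa a G Z => [|a' Fa IH] a G Z u sG; first exact: block_stop_wf.
rewrite block_cons; case: leqP => sZG.
  by apply: block_stop_wf; fresh_qubit u.
cbv zeta; set W := take _ Z; set Z' := drop _ Z.
have ZE : Z = W ++ Z' by rewrite cat_take_drop.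
rewrite ZE in u.
have wfl : all (@rgate_wf m) (link a a' W G).
  by apply: link_wf => //; fresh_qubit u.
rewrite !all_cat carry_up_wf //; last by fresh_qubit u.
rewrite wfl IH //; last by fresh_qubit u.
rewrite [all _ (_ :: _)]/= all_cat all_rev wfl carry_down_wf //; last by fresh_qubit u.
by rewrite /= andbT; apply/andP; split=> //; fresh_qubit u.
Qed.

(** A block of [s] bits costs [3 * (s - 1)] for the ladder, 2 for [link] and its inverse, and 1 for
    [d]: [3 * s]. The extra 1 is the Toffoli of [block_stop]. *)
Lemma block_ntof a G Fa Z :
  (0 < size G)%N -> (ntof (block inner c d a G Fa Z) <= 3 * size Z + 1)%N.
Proof.
have stop a1 G1 Z1 : (ntof (block_stop inner c d a1 G1 Z1) <= 3 * size Z1 + 1)%N.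
  rewrite /block_stop !ntof_cons ntof_cat !ntof_cons /=.
  by have := inner_ntof (a1 :: G1) Z1; lia.
elim: Fa a G Z => [|a' Fa IH] a G Z sG; first exact: stop.
rewrite block_cons; case: (leqP (size Z) (size G)) => sZG; first exact: stop.
rewrite !(ntof_cat, ntof_cons, ntof_rev, ntof_fan) /=.
set W := take _ Z; set Z' := drop _ Z.
have sW : size W = size G by rewrite size_take sZG.
have sZ' : size Z' = (size Z - size G)%N by rewrite size_drop.
have := IH a' (a :: W ++ G) Z' isT.
have := ntof_carry_up W G; have := ntof_carry_down d W G.
by rewrite sW sZ'; lia.
Qed.

(** A block of [s] bits has at most [3 * s] ladder gates, [2 * (2 * s + 2)] for [link] and its
    inverse, and one more: [7 * s + 5], at most [12 * s] as [s] is positive. The extra 3 comes from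
    [block_stop]. *)
Lemma block_size a G Fa Z :
  (0 < size G)%N -> (size (block inner c d a G Fa Z) <= 12 * size Z + 3)%N.
Proof.
have stop a1 G1 Z1 : (size (block_stop inner c d a1 G1 Z1) <= 12 * size Z1 + 3)%N.
  rewrite /block_stop /= size_cat /=.
  by have := inner_size (a1 :: G1) Z1; lia.
elim: Fa a G Z => [|a' Fa IH] a G Z sG; first exact: stop.
rewrite block_cons; case: (leqP (size Z) (size G)) => sZG; first exact: stop.
cbv zeta; set W := take _ Z; set Z' := drop _ Z.
have sW : size W = size G by rewrite size_take sZG.
have sZ' : size Z' = (size Z - size G)%N by rewrite size_drop.
have sl : size (link a a' W G) = (size W + size G).+2.
  by rewrite /= size_fan size_cat.
rewrite !(size_cat, size_rev, sl) [size (_ :: _)]/= !(size_cat, size_rev, sl).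
have := IH a' (a :: W ++ G) Z' isT.
have := size_carry_up [::] W G; have := size_carry_down d [::] W G.
by rewrite sW sZ'; lia.
Qed.

End Block.

(** * Recursion over the clean ancillas *)

Definition ladder c F Z : seq (rgate m) :=
  carry_up [::] Z F ++ carry_down c [::] Z F.

(** When [c] is 1, [a] is 0 and the two leading CNOT gates move the bit [z] into [a], leaving [z] at
    0: [a] is the first carry and [[:: z]] the initial supply. The last four gates clear [d], undo
    the move and flip [z] under [c]. *)
Fixpoint level A c F Z : seq (rgate m) :=
  match A, F, Z with
  | d :: A', a :: Fa, z :: Z' =>
      if (size Z <= size F)%N then ladder c F Z else
      ([:: z], a) :: ([:: a], z) :: block (level A' d) c d a [:: z] Fa Z'
        ++ [:: ([:: c; a], d); ([:: a], z); ([:: z], a); ([:: c], z)]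
  | _, _, _ => ladder c F Z
  end.

Lemma level_cons d A c a Fa z Z :
  level (d :: A) c (a :: Fa) (z :: Z) =
    if (size (z :: Z) <= size (a :: Fa))%N then ladder c (a :: Fa) (z :: Z) else
    ([:: z], a) :: ([:: a], z) :: block (level A d) c d a [:: z] Fa Z
      ++ [:: ([:: c; a], d); ([:: a], z); ([:: z], a); ([:: c], z)].
Proof. by []. Qed.

Lemma ladder_wf c F Z : uniq (c :: F ++ Z) -> all (@rgate_wf m) (ladder c F Z).
Proof.
move=> u; rewrite all_cat carry_up_wf //; last by fresh_qubit u.
by rewrite carry_down_wf //; fresh_qubit u.
Qed.

Lemma ladder_ntof c F Z : (ntof (ladder c F Z) <= 3 * size Z)%N.
Proof.
rewrite ntof_cat; have := ntof_carry_up Z F.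
by have := ntof_carry_down c Z F; lia.
Qed.

Lemma ladder_size c F Z : (size (ladder c F Z) <= 3 * size Z)%N.
Proof.
rewrite size_cat; have := size_carry_up [::] Z F.
by have := size_carry_down c [::] Z F; lia.
Qed.

Lemma level_wf A c F Z :
  uniq (c :: F ++ A ++ Z) -> all (@rgate_wf m) (level A c F Z).
Proof.
elim: A c F Z => [|d A IH] c F Z u; first by apply: ladder_wf; fresh_qubit u.
case: F Z u => [|a Fa] [|z Z] u; try by apply: ladder_wf; fresh_qubit u.
rewrite level_cons; case: (leqP (size (z :: Z)) (size (a :: Fa))) => sZF;
  first by apply: ladder_wf; fresh_qubit u.
have za : rgate_wf ([:: z], a) by apply/andP; split=> //; fresh_qubit u.
have az : rgate_wf ([:: a], z) by apply/andP; split=> //; fresh_qubit u.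
have cad : rgate_wf ([:: c; a], d) by apply/andP; split=> //; fresh_qubit u.
have cz : rgate_wf ([:: c], z) by apply/andP; split=> //; fresh_qubit u.
have wfb : all (@rgate_wf m) (block (level A d) c d a [:: z] Fa Z).
  by apply: (@block_wf _ c d A (IH d)) => //; fresh_qubit u.
by rewrite !wf_cons all_cat wfb !wf_cons za az cad cz.
Qed.

(** The lowest bit has an allowance of 3 and uses 2: the surplus Toffoli of the block and the one
    that clears [d]. *)
Lemma level_ntof A c F Z : (ntof (level A c F Z) <= 3 * size Z)%N.
Proof.
elim: A c F Z => [|d A IH] c F Z; first exact: ladder_ntof.
case: F Z => [|a Fa] [|z Z]; try exact: ladder_ntof.
rewrite level_cons; case: (leqP (size (z :: Z)) (size (a :: Fa))) => sZF;
  first exact: ladder_ntof.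
rewrite !ntof_cons ntof_cat !ntof_cons /=.
have := @block_ntof (level A d) c d (IH d) a [:: z] Fa Z isT.
by lia.
Qed.

Lemma level_size A c F Z : (size (level A c F Z) <= 12 * size Z)%N.
Proof.
have lad c1 F1 Z1 : (size (ladder c1 F1 Z1) <= 12 * size Z1)%N.
  by apply: leq_trans (ladder_size _ _ _) _; rewrite leq_mul2r orbT.
elim: A c F Z => [|d A IH] c F Z; first exact: lad.
case: F Z => [|a Fa] [|z Z]; try exact: lad.
rewrite level_cons; case: (leqP (size (z :: Z)) (size (a :: Fa))) => sZF;
  first exact: lad.
rewrite /= size_cat /=.
have := @block_size (level A d) c d (IH d) a [:: z] Fa Z isT.
by lia.
Qed.

Lemma ladderE c F Z (b : bits m) :
  (size Z <= size F)%N -> uniq (c :: F ++ Z) -> (b c -> zero b F) ->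
  exec (ladder c F Z) b = cinc (b c) Z b.
Proof.
move=> sZF u F0; rewrite exec_cat carry_downK ?andbT //.
by fresh_qubit u.
Qed.

Lemma levelE A c F Z (b : bits m) :
  uniq (c :: F ++ A ++ Z) -> (0 < size F)%N ->
  (size Z <= iter (size A) (expn 2) (size F))%N ->
  zero b A -> (b c -> zero b F) ->
  exec (level A c F Z) b = cinc (b c) Z b.
Proof.
elim: A c F Z b => [|d A IH] c F Z b u sF sZ A0 F0.
  by apply: ladderE => //; fresh_qubit u.
case: F Z u sF sZ F0 => [|a Fa] [|z Z] // u _ sZ F0.
rewrite level_cons; case: (leqP (size (z :: Z)) (size (a :: Fa))) => sZF.
  by apply: ladderE => //; fresh_qubit u.
have zacd : z \notin [:: a; c; d] by fresh_qubit u.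
have acd : a \notin [:: c; d] by fresh_qubit u.
have AZ : {in A, forall q, q \notin [:: z; a]} by fresh_qubit u.
have FaZ : {in Fa, forall q, q \notin [:: z; a]} by fresh_qubit u.
have ZN : {in Z, forall q, q \notin [:: z; a; c; d]} by fresh_qubit u.
have aZ : a \notin Z by fresh_qubit u.
have cZ : c \notin Z by fresh_qubit u.
have dZ : d \notin Z by fresh_qubit u.
have zZ : z \notin Z by fresh_qubit u.
have ddA : d \in d :: A by rewrite mem_head.
move: zacd acd; rewrite !inE !negb_or.
case/and3P=> /negPf za /negPf zc /negPf zd /andP[/negPf ac /negPf ad].
set s := exec [:: ([:: z], a); ([:: a], z)] b.
have sE q : q \notin [:: z; a] -> s q = b q.
  move=> qn; apply: exec_nontarget.
  by move: qn; rewrite /= !inE orbC.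
have sa : s a = b a (+) b z.
  by rewrite /s /= /exec_gate /= !flipE eqxx eq_sym za /= addbF andbT.
have sz : s z = b z (+) s a.
  by rewrite sa /s /= /exec_gate /= !flipE !eqxx za /= !andbT addbF.
have sc : s c = b c by apply: sE; rewrite !inE ![c == _]eq_sym zc ac.
have sd : s d = false.
  by rewrite sE ?A0 // !inE ![d == _]eq_sym zd ad.
rewrite -[_ :: _ :: _ ++ _]/([:: _; _] ++ _ ++ _) exec_cat -/s exec_cat.
rewrite (blockE (A := A)) //; first last.
- rewrite sc => /andP[bc sa1] q; rewrite inE => /eqP->.
  by move: sa; rewrite sz sa1 F0 ?mem_head //= => <-.
- by rewrite sc => bc q qFa; rewrite sE ?FaZ // F0 // inE qFa orbT.
- by move=> q qA; rewrite sE ?AZ // A0 // inE qA orbT.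
(* The supply count starts at [size [:: z] + 1 = 2] and doubles along [Fa], reaching
   [2 ^ size (a :: Fa)]: one level of the tower per ancilla. *)
- apply: leq_trans (ltnW sZ) _; by rewrite [size (d :: A)]/= iterSr expnS.
- by fresh_qubit u.
- exact: IH.
set e := s c && s a; set t := cinc e Z s.
have te : e = b c && b z.
  rewrite /e sc sa; case bc: (b c) => //=.
  by rewrite F0 ?mem_head.
rewrite -cat1s exec_cat.
(* The controls [c] and [a] are outside [Z], so they still give [e] and the Toffoli clears [d]. *)
have -> : exec [:: ([:: c; a], d)] (flip e d t) = t.
  rewrite /= /exec_gate /= flip_flip !flipE [c == d]eq_sym.
  have -> : (d == c) = false.
    apply/negP => /eqP dc; have : c \notin [:: d] by fresh_qubit u.
    by rewrite dc inE eqxx.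
  by rewrite ad /= !addbF /t !cinc_notin // andbT -/e addbb flip_id.
rewrite -[[:: _; _; _]]/(rev [:: ([:: z], a); ([:: a], z)] ++ [:: ([:: c], z)]).
rewrite exec_cat /t exec_cinc; last first.
  move=> q /ZN; rewrite !inE !negb_or => /and4P[qz qa _ _].
  by rewrite /= !inE !negb_or qz qa.
rewrite exec_rev; last first.
  by rewrite /= /rgate_wf /= !inE eq_sym za.
by rewrite /= /exec_gate /= cinc_notin // andbT te.
Qed.

End Cost.

(** * Compilation to quantum gates *)

Section Compile.
Variables (m : nat) (K : numClosedFieldType).
Implicit Types (b : bits m) (q : 'I_m) (g : rgate m) (C : seq (rgate m)).
Implicit Types (psi phi : state m K).

(** The quantum gates carry proofs that their qubits are distinct, so these are decided here;
    ill-formed gates compile to nothing. *)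
Definition compile_gate g : circuit m :=
  match g.1 with
  | [::] => [:: Hadamard g.2; Phase g.2; Phase g.2; Hadamard g.2]
  | [:: c] => if Bool.bool_dec (c != g.2) true is left ct then [:: CNOT ct] else [::]
  | [:: x; y] =>
      if Bool.bool_dec (uniq [:: x; y; g.2]) true is left u then [:: Toffoli u] else [::]
  | _ => [::]
  end.

Definition compile C : circuit m := flatten [seq compile_gate g | g <- C].

Lemma gate_applyD h psi phi :
  gate_apply h (psi + phi) = gate_apply h psi + gate_apply h phi.
Proof.
rewrite /gate_apply -big_split; apply: eq_bigr => b _ /=.
by rewrite ffunE scalerDl.
Qed.

Lemma gate_applyZ h (k : K) psi :
  gate_apply h (k *: psi) = k *: gate_apply h psi.
Proof.
rewrite /gate_apply scaler_sumr; apply: eq_bigr => b _ /=.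
by rewrite ffunE scalerA.
Qed.

Lemma gate_apply_ket h b : gate_apply h (ket K b) = gate_ket K h b.
Proof.
rewrite /gate_apply (bigD1 b) //= big1 ?addr0 => [|b' /negPf bb'].
  by rewrite ffunE eqxx scale1r.
by rewrite ffunE bb' scale0r.
Qed.

Lemma set_bit_set_bit b q v w : set_bit (set_bit b q v) q w = set_bit b q w.
Proof. by apply/ffunP => x; rewrite !ffunE; case: eqP. Qed.

(** Two phase gates make Z, and H Z H is X exactly, with no global phase. *)
Lemma run_not q b :
  run [:: Hadamard q; Phase q; Phase q; Hadamard q] (ket K b)
    = ket K (flip true q b).
Proof.
pose A := ket K (set_bit b q false); pose B := ket K (set_bit b q true).
pose r : K := (sqrtC 2)^-1.
have rr : r * r = 2^-1 by rewrite -invfM -expr2 sqrtCK.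
have HE : gate_apply (Hadamard q) (ket K b) = r *: (A + (-1) ^+ b q *: B).
  by rewrite gate_apply_ket.
have PA : gate_apply (Phase q) A = A.
  by rewrite gate_apply_ket /= ffunE eqxx expr0 scale1r.
have PB : gate_apply (Phase q) B = 'i *: B.
  by rewrite gate_apply_ket /= ffunE eqxx expr1.
have HA : gate_apply (Hadamard q) A = r *: (A + B).
  by rewrite gate_apply_ket /= !set_bit_set_bit ffunE eqxx expr0 scale1r.
have HB : gate_apply (Hadamard q) B = r *: (A - B).
  by rewrite gate_apply_ket /= !set_bit_set_bit ffunE eqxx expr1 scaleN1r.
rewrite /run [foldl _ _ _]/= HE !(gate_applyZ, gate_applyD, PA, PB, HA, HB).
rewrite -[RHS]/(ket K (set_bit b q (b q (+) true))) addbT.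
have -> : ket K (set_bit b q (~~ b q)) = if b q then A else B by case: (b q).
have ii : 'i * 'i = -1 :> K by rewrite -expr2 sqrCi.
have half (v : state m K) : 2^-1 *: (v + v) = v.
  by rewrite -mulr2n -scaler_nat scalerA mulVf ?scale1r // pnatr_eq0.
rewrite ['i *: ('i *: _)]scalerA ii scaleN1r; case: (b q) => /=.
  rewrite expr1 scaleN1r opprK -scalerDr scalerA rr.
  by rewrite addrACA subrr addr0 half.
rewrite expr0 scale1r -scalerBr scalerA rr opprB.
by rewrite [A + B]addrC addrACA subrr addr0 half.
Qed.

Lemma run_compile_gate g b : rgate_wf g ->
  run (compile_gate g) (ket K b) = ket K (exec_gate g b).
Proof.
case: g => [s t]; rewrite /rgate_wf /compile_gate /=.
case: s => [|x [|y [|? ?]]] //= wf; first exact: run_not.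
  have xt : x != t by move: wf; rewrite !inE !andbT eq_sym.
  by case: Bool.bool_dec => // ct; rewrite /run /= gate_apply_ket /exec_gate /= /flip andbT.
have u : uniq [:: x; y; t].
  by rewrite -(rot_uniq 2); case/andP: wf.
by case: Bool.bool_dec => // ct; rewrite /run /= gate_apply_ket /exec_gate /= /flip andbT.
by rewrite andbF in wf.
Qed.

Lemma run_compile C b : all (@rgate_wf m) C ->
  run (compile C) (ket K b) = ket K (exec C b).
Proof.
elim: C b => [|g C IH] b //; rewrite wf_cons => /andP[wfg wfC].
by rewrite [run _ _]foldl_cat [foldl _ _ (compile_gate g)]run_compile_gate // -IH.
Qed.

End Compile.

Section CompileCost.
Variable m : nat.
Implicit Types (g : rgate m) (C : seq (rgate m)).

Lemma toffoli_count_compile C : (toffoli_count (compile C) <= ntof C)%N.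
Proof.
elim: C => //= g C IH; rewrite /toffoli_count /compile /= count_cat leq_add //.
case: g => [[|x [|y [|? ?]]] t] //; rewrite /compile_gate /=.
  by case: Bool.bool_dec.
by case: Bool.bool_dec.
Qed.

Lemma size_compile C : (size (compile C) <= 4 * size C)%N.
Proof.
elim: C => //= g C IH; rewrite /compile /= size_cat mulnS leq_add //.
case: g => [[|x [|y [|? ?]]] t] //; rewrite /compile_gate /=.
  by case: Bool.bool_dec.
by case: Bool.bool_dec.
Qed.

Lemma depth_size (c : circuit m) : (depth c <= size c)%N.
Proof.
rewrite /depth; case: ex_minnP => k _; apply.
apply/existsP; exists [ffun i => i].
apply/forallP => i; apply/forallP => j; apply/implyP => ltij.
by apply/implyP => _; rewrite !ffunE ltnW //= neq_ltn ltij.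
Qed.

End CompileCost.

(** * Binary digits and the register *)

Lemma odd_succ_div x i :
  odd ((x + 1) %/ 2 ^ i)
    = odd (x %/ 2 ^ i) (+) all (fun j => odd (x %/ 2 ^ j)) (iota 0 i).
Proof.
(* The induction needs the whole quotient, not only its parity: the carry into bit [i] is the AND of
   the lower bits. *)
have -> : ((x + 1) %/ 2 ^ i =
    x %/ 2 ^ i + all (fun j => odd (x %/ 2 ^ j)) (iota 0 i))%N.
  elim: i => [|i IH]; first by rewrite !divn1.
  have -> : iota 0 i.+1 = iota 0 i ++ [:: i] by rewrite -[i.+1]addn1 iotaD.
  rewrite expnSr !divnMA IH all_cat all_seq1.
  set q := (x %/ 2 ^ i)%N; case: all => /=; last by rewrite !addn0.
  by lia.
by rewrite oddD oddb.
Qed.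

Lemma odd_mod_div y n i : (i < n)%N ->
  odd ((y %% 2 ^ n) %/ 2 ^ i) = odd (y %/ 2 ^ i).
Proof.
move=> lt_in; rewrite {2}(divn_eq y (2 ^ n)).
(* As [i < n], the discarded multiple of [2 ^ n] contributes an even number to the quotient. *)
rewrite -(subnK (ltnW lt_in)) expnD mulnA divnMDl ?expn_gt0 // oddD.
by rewrite oddM oddX orbF subn_eq0 leqNgt lt_in andbF.
Qed.

Section Register.
Variables (n a : nat).

Definition register : seq 'I_(n + a) := [seq lshift a i | i <- enum 'I_n].
Definition ancillas : seq 'I_(n + a) := [seq rshift n i | i <- enum 'I_a].

Lemma zero_ancillas x : zero (register_bits n a x) ancillas.
Proof.
move=> q /mapP[i _ ->]; rewrite ffunE.
by case: split_ordP => // j /eqP; rewrite eq_rlshift.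
Qed.

Lemma uniq_register_ancillas : uniq (register ++ ancillas).
Proof.
rewrite cat_uniq (map_inj_uniq (@lshift_inj _ _)) (map_inj_uniq (@rshift_inj _ _)).
rewrite !enum_uniq /= andbT; apply/hasPn => q /mapP[i _ ->].
by apply/mapP => -[j _ /eqP]; rewrite eq_rlshift.
Qed.

Lemma cinc_register x :
  cinc true register (register_bits n a x)
    = register_bits n a ((x + 1) %% 2 ^ n).
Proof.
have ur : uniq register by move: uniq_register_ancillas; rewrite cat_uniq => /andP[].
apply/ffunP => q; rewrite cincE // /register.
case: (split_ordP q) => i ->; last first.
  rewrite [_ \in _](introF mapP) ?addbF ?zero_ancillas //;
    try by apply/mapP; exists i; rewrite ?mem_enum.
  by case=> j _ /eqP; rewrite eq_rlshift.
have bitE y j : register_bits n a y (lshift a j) = odd (y %/ 2 ^ j).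
  by rewrite ffunE; case: split_ordP => k /eqP; rewrite ?eq_lrshift // eq_lshift => /eqP<-.
rewrite map_f ?mem_enum // index_map; last exact: lshift_inj.
rewrite index_enum_ord -map_take all_map /= !bitE odd_mod_div // odd_succ_div.
congr (_ (+) _).
rewrite -[in LHS](eq_all (a1 := (fun j : nat => odd (x %/ 2 ^ j)) \o val)) => [|j];
  last by rewrite /= bitE.
by rewrite -all_map map_take val_enum_ord take_iota (minn_idPl (ltnW (ltn_ord i))).
Qed.

End Register.

(** * The incrementer *)

Section Incrementer.
Variable m : nat.
Implicit Types (x y : 'I_m) (A Z : seq 'I_m).

(** After [init], [d] is the carry out of the two lowest bits and, if it is 1, [x] and [y] are 0.
    They are the initial supply for [level], and are themselves incremented at the end without a
    Toffoli gate. *)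
Definition incrementer x y d A Z : seq (rgate m) :=
  let init := [:: ([:: x; y], d); ([:: d], x); ([:: d], y)] in
  init ++ level A d [:: x; y] Z ++ rev init ++ [:: ([:: x], y); ([::], x)].

Lemma incrementerE x y d A Z (b : bits m) :
  uniq (x :: y :: d :: A ++ Z) -> (size Z <= iter (size A).+1 (expn 2) 1)%N ->
  zero b (d :: A) -> exec (incrementer x y d A Z) b = cinc true (x :: y :: Z) b.
Proof.
move=> u sZ A0; rewrite /incrementer; set init := [:: _; _; _].
have xyd : x \notin [:: y; d] by fresh_qubit u.
have yd : y \notin [:: d] by fresh_qubit u.
have AN : {in A, forall q, q \notin [:: x; y; d]} by fresh_qubit u.
have ZN : {in Z, forall q, q \notin [:: x; y; d]} by fresh_qubit u.
have xZ : x \notin Z by fresh_qubit u.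
have yZ : y \notin Z by fresh_qubit u.
have d0 : b d = false by rewrite A0 ?mem_head.
move: xyd yd; rewrite !inE !negb_or => /andP[/negPf xy /negPf xd] /negPf yd.
rewrite !exec_cat; set s := exec init b.
have sE q : q \notin [:: x; y; d] -> s q = b q.
  move=> qn; apply: exec_nontarget; apply: contra qn.
  by rewrite /= !inE => /or3P[]->; rewrite ?orbT.
have sd : s d = b x && b y.
  rewrite /s /= /exec_gate /= !flipE eqxx ![d == _]eq_sym xd yd d0 /=.
  by rewrite !andbT !addbF.
have sx : s x = b x (+) s d.
  by rewrite sd /s /= /exec_gate /= !flipE !eqxx xy xd ![d == _]eq_sym xd d0 /= !andbT !addbF.
have sy : s y = b y (+) s d.
  rewrite sd /s /= /exec_gate /= !flipE !eqxx ![y == x]eq_sym xy yd.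
  by rewrite ![d == _]eq_sym xd d0 /= !andbT !addbF.
rewrite levelE //; first last.
- rewrite sd => /andP[bx by1] q; rewrite !inE => /orP[]/eqP->.
    by rewrite sx sd bx by1.
  by rewrite sy sd bx by1.
- by move=> q qA; rewrite sE ?AN // A0 // inE qA orbT.
(* The supply of two qubits is [2 ^ 1], so [d] also accounts for one level of the tower. *)
- by rewrite -[size [:: x; y]]/(2 ^ 1)%N -iterSr.
- by fresh_qubit u.
have initZ : {in Z, forall q, avoids q (rev init)}.
  by move=> q /ZN; rewrite /avoids all_rev /= !inE !negb_or => /and3P[-> -> ->].
rewrite exec_cinc // exec_rev; last first.
  by rewrite /= /rgate_wf /= !inE ![d == _]eq_sym !negb_or xd yd xy.
by rewrite /= /exec_gate /= cinc_notin // !andbT sd.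
Qed.

Lemma incrementer_wf x y d A Z :
  uniq (x :: y :: d :: A ++ Z) -> all (@rgate_wf m) (incrementer x y d A Z).
Proof.
move=> u; rewrite /incrementer; set init := [:: _; _; _].
have wfi : all (@rgate_wf m) init.
  by rewrite !wf_cons; apply/and4P; split=> //; apply/andP; split=> //; fresh_qubit u.
rewrite !all_cat all_rev wfi level_wf ?wf_cons; last by fresh_qubit u.
by rewrite /= andbT; apply/andP; split=> //; fresh_qubit u.
Qed.

Lemma incrementer_ntof x y d A Z :
  (ntof (incrementer x y d A Z) <= 3 * size (x :: y :: Z))%N.
Proof.
rewrite !ntof_cat ntof_rev !ntof_cons /=.
by have := level_ntof A d [:: x; y] Z; lia.
Qed.

Lemma incrementer_size x y d A Z :
  (size (incrementer x y d A Z) <= 12 * size (x :: y :: Z))%N.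
Proof.
rewrite !size_cat size_rev /=.
by have := level_size A d [:: x; y] Z; lia.
Qed.

End Incrementer.

(** * The iterated logarithm as an inverse of the tower of powers of two *)

Section LogStar.
Variable R : realType.

Lemma iter_log2_le k (x : R) :
  iter k (@log2 R) x <= 1 -> x <= (iter k (expn 2) 1)%:R.
Proof.
elim: k x => [|k IH] x //; rewrite iterSr => /IH lex.
have ln2_gt0 : 0 < ln 2 :> R by rewrite ln_gt0 // ltr1n.
(* For nonpositive [x], where [ln] has a default value, the bound is immediate; monotonicity of [ln]
   is used only for positive [x]. *)
have [x_le0|x_gt0] := leP x 0; first exact: le_trans x_le0 _.
rewrite iterS natrX -ler_ln ?posrE ?exprn_gt0 // lnXn //.
by rewrite -[ln 2 *+ _]mulr_natl -ler_pdivrMr.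
Qed.

Lemma leq_tower_log_star n : (n <= iter (log_star R n) (expn 2) 1)%N.
Proof.
rewrite /log_star; case: ex_minnP => k klog _.
by rewrite -(ler_nat R); apply: iter_log2_le.
Qed.

End LogStar.

Lemma exists_incrementer n a :
  (0 < n)%N -> (n <= iter a (expn 2) 1)%N ->
  exists C : seq (rgate (n + a)),
    [/\ all (@rgate_wf _) C,
        forall b, zero b (ancillas n a) -> exec C b = cinc true (register n a) b,
        (ntof C <= 3 * n)%N & (size C <= 12 * n)%N].
Proof.
move=> n_gt0 len.
have sr : size (register n a) = n by rewrite size_map size_enum_ord.
have sa : size (ancillas n a) = a by rewrite size_map size_enum_ord.
have := uniq_register_ancillas n a.
(* A one-bit register needs a single NOT and no ancilla. *)
case: (register n a) sr => [|x [|y Z]] /= sr; first by rewrite -sr in n_gt0.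
  move=> _; exists [:: ([::], x)]; split=> //=.
  by rewrite muln_gt0.
(* With at least two bits there is an ancilla, since the tower of height 0 is 1. *)
case: (ancillas n a) sa => [|d A] /= sa u.
  by exfalso; move: len; rewrite -sa -sr.
have u' : uniq (x :: y :: d :: A ++ Z).
  by move: u; rewrite -[_ && _]/(uniq (x :: y :: Z ++ d :: A)) => u; fresh_qubit u.
exists (incrementer x y d A Z); split.
- exact: incrementer_wf.
- move=> b b0; apply: incrementerE => //.
  by rewrite sa; apply: leq_trans len; rewrite -[leqRHS]sr leqW.
- by apply: leq_trans (incrementer_ntof _ _ _ _ _) _; rewrite /= sr.
- by apply: leq_trans (incrementer_size _ _ _ _ _) _; rewrite /= sr.
Qed.

Theorem mainTheorem2 (R : realType) :
  exists C : R, 0 < C /\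
    forall n : nat, (1 <= n)%N ->
      exists c : circuit (n + log_star R n),
        [/\ implements_incrementer R[i] c,
            (toffoli_count c <= 3 * n)%N
          & (depth c)%:R <= C * n%:R].
Proof.
(* At most 12 reversible gates per bit, each compiled to at most 4 quantum gates, as NOT is. *)
exists 48%:R; split=> [|n n_gt0]; first by rewrite ltr0n.
have [C [wfC CE tofC sizeC]] := exists_incrementer n_gt0 (leq_tower_log_star R n).
exists (compile C); split.
- move=> x _; rewrite /register_ket run_compile // CE ?cinc_register //.
  exact: zero_ancillas.
- exact: leq_trans (toffoli_count_compile _) tofC.
- rewrite -natrM ler_nat; apply: leq_trans (depth_size _) _.
  apply: leq_trans (size_compile _) _.
  by rewrite -[48%N]/(4 * 12)%N -mulnA leq_mul2l.
Qed.
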